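(* Let $D$ be a division ring, $V$ a right vector space over $D$, and $x$ a vector space endomorphism of $V$ such that $V$ can be written as a direct sum of $x$-invariant subspaces, each of which is either finite-dimensional, or has the property that the action of $x$ on it is one-to-one, or has the property that the action of $x$ on it is surjective. Then $x$ has a strong inner inverse $y$ in $\mathrm{End}_D(V)$, which carries each of those direct summands into itself. If, moreover, this decomposition of $V$ includes, for each positive integer $n$, at least one $n$-dimensional summand which is $x$-basic, then a strong inner inverse $y$ to $x$ can be chosen so that the ring of additive-group endomorphisms of $V$ generated by the action of $D$ and the actions of $x$ and $y$ has precisely the structure of the monoid ring $D\,\mathcal{F}$. In particular, if $D$ is a field $k$, this says that the $k$-algebra of endomorphisms of $V$ generated by $x$ and $y$ is isomorphic to the monoid algebra $k\,\mathcal{F}$.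
   Context: $\mathcal{F}$ denotes the monoid presented by two generators $x,y$ and the relations $x^i y^j x^k = y^{j-i}x^j y^{j-k}$ for all integers $i,j,k$ with $0\le i\le j$ and $0\le k\le j$. For elements $x,y$ of a monoid $M$, $y$ is called a strong inner inverse to $x$ (in $M$) if $x^i y^j x^k = y^{j-i}x^j y^{j-k}$ for all integers $i,j,k$ with $0\le i\le j$ and $0\le k\le j$; equivalently, if there is a monoid homomorphism $\mathcal{F}\to M$ carrying the generators $x,y$ of $\mathcal{F}$ to the elements $x,y$ of $M$. For rings such as $\mathrm{End}_D(V)$, the ring of $D$-vector-space endomorphisms of $V$, the multiplicative monoid is meant. A nonzero $x$-invariant subspace $W$ of $V$ is called $x$-basic if it admits a basis $b_1,\dots,b_n$ such that $x(b_h)=b_{h+1}$ for $h<n$, and $x(b_n)=0$. $D\,\mathcal{F}$ denotes the monoid ring of $\mathcal{F}$ with coefficients in $D$, in which the elements of $D$ commute with the elements of $\mathcal{F}$. *)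

(* Defs.v *)
From HB Require Import structures.
From mathcomp Require Import all_boot all_order all_algebra generic_quotient.
From mathcomp Require Import finmap boolp classical_sets functions.
From mathcomp.multinomials Require Import monalg.

Set Implicit Arguments.
Unset Strict Implicit.
Unset Printing Implicit Defensive.

Import GRing.Theory.
Local Open Scope ring_scope.
Local Open Scope classical_set_scope.

Definition strong_inner_inverse (M : pzRingType) (x y : M) : Prop :=
  forall i j k : nat, (i <= j)%N -> (k <= j)%N ->
    x ^+ i * y ^+ j * x ^+ k = y ^+ (j - i) * x ^+ j * y ^+ (j - k).

(* The monoid congruence presenting F. A word in the generators is a list of booleans: [true] is the letter x
   and [false] is the letter y. *)
Inductive F_cong : seq bool -> seq bool -> Prop :=
| F_cong_rel (i j k : nat) : (i <= j)%N -> (k <= j)%N ->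
    F_cong (nseq i true ++ nseq j false ++ nseq k true)
           (nseq (j - i) false ++ nseq j true ++ nseq (j - k) false)
| F_cong_refl u : F_cong u u
| F_cong_sym u v : F_cong u v -> F_cong v u
| F_cong_trans v u w : F_cong u v -> F_cong v w -> F_cong u w
| F_cong_cat u u' v v' : F_cong u u' -> F_cong v v' -> F_cong (u ++ v) (u' ++ v').

Definition F_eqb (u v : seq bool) : bool := `[< F_cong u v >].

Lemma F_eqb_refl : reflexive F_eqb.
Proof. by move=> u; apply/asboolP; apply: F_cong_refl. Qed.

Lemma F_eqb_sym : symmetric F_eqb.
Proof. by move=> u v; apply/asboolP/asboolP; apply: F_cong_sym. Qed.

Lemma F_eqb_trans : transitive F_eqb.
Proof.
by move=> v u w /asboolP uv /asboolP vw; apply/asboolP; apply: F_cong_trans vw.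
Qed.

Canonical F_equiv := EquivRel F_eqb F_eqb_refl F_eqb_sym F_eqb_trans.

Definition monF := {eq_quot F_equiv}%qT.
HB.instance Definition _ := Choice.on monF.
HB.instance Definition _ := Quotient.on monF.

Definition F_of (w : seq bool) : monF := \pi_monF%qT w.

Lemma F_ofP u v : F_of u = F_of v <-> F_cong u v.
Proof.
split; first by move=> /eqmodP /asboolP.
by move=> uv; apply/eqmodP/asboolP.
Qed.

Lemma F_of_surj (f : monF) : F_of (repr f) = f.
Proof. exact: reprK. Qed.

Definition F_one : monF := F_of [::].
Definition F_mul (f g : monF) : monF := F_of (repr f ++ repr g).

Lemma F_mul_of u v : F_mul (F_of u) (F_of v) = F_of (u ++ v).
Proof. by apply/F_ofP/F_cong_cat; apply/F_ofP; rewrite F_of_surj. Qed.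

Lemma F_mulA : associative F_mul.
Proof.
move=> f g h; rewrite -(F_of_surj f) -(F_of_surj g) -(F_of_surj h).
by rewrite !F_mul_of catA.
Qed.

Lemma F_mul1 : left_id F_one F_mul.
Proof. by move=> f; rewrite -(F_of_surj f) F_mul_of. Qed.

Lemma F_mulr1 : right_id F_one F_mul.
Proof. by move=> f; rewrite -(F_of_surj f) F_mul_of cats0. Qed.

Lemma F_cong_nil u v : F_cong u v -> (u == [::]) = (v == [::]).
Proof.
elim=> {u v} [i j k ij kj|//|u v _ -> //|v u w _ -> _ //|u u' v v' _ + _].
  rewrite -!size_eq0 !size_cat !size_nseq !addn_eq0.
  by case: j ij kj => [|j]; rewrite ?andbF // !leqn0 => /eqP-> /eqP->.
by rewrite -!size_eq0 !size_cat !addn_eq0 => -> ->.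
Qed.

Lemma F_unit (f g : monF) : F_mul f g = F_one -> f = F_one /\ g = F_one.
Proof.
rewrite -(F_of_surj f) -(F_of_surj g) F_mul_of => /F_ofP/F_cong_nil.
by rewrite eqxx; case: (repr f) (repr g) => [|? ?] [|? ?].
Qed.

HB.instance Definition _ :=
  Choice_isMonomialDef.Build monF F_mulA F_mul1 F_mulr1 F_unit.

Definition F_x : monF := F_of [:: true].
Definition F_y : monF := F_of [:: false].

(* The ring of additive-group endomorphisms of [V], multiplied by composition:
   [f * g] is [f \o g]. *)
Definition zend (V : zmodType) := {additive V -> V}.

Section AdditiveEndomorphisms.
Variable V : zmodType.
Implicit Types f g h : zend V.

HB.instance Definition _ := gen_eqMixin (zend V).
HB.instance Definition _ := gen_choiceMixin (zend V).

Lemma zendP f g : f =1 g -> f = g.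
Proof.
case: f g => f [[cf]] [g [[cg]]] /= /funext fg; subst g.
by rewrite (Prop_irrelevance cf cg).
Qed.

Definition zend_zero : zend V := \0.
Definition zend_opp f : zend V := \- f.
Definition zend_add f g : zend V := f \+ g.
Definition zend_one : zend V := idfun.
Definition zend_mul f g : zend V := f \o g.

Lemma zend_addA : associative zend_add.
Proof. by move=> f g h; apply: zendP => v /=; rewrite addrA. Qed.
Lemma zend_addC : commutative zend_add.
Proof. by move=> f g; apply: zendP => v /=; rewrite addrC. Qed.
Lemma zend_add0 : left_id zend_zero zend_add.
Proof. by move=> f; apply: zendP => v /=; rewrite add0r. Qed.
Lemma zend_addN : left_inverse zend_zero zend_opp zend_add.
Proof. by move=> f; apply: zendP => v /=; rewrite addNr. Qed.

HB.instance Definition _ := GRing.isZmodule.Build (zend V)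
  zend_addA zend_addC zend_add0 zend_addN.

Lemma zend_mulA : associative zend_mul.
Proof. by move=> f g h; apply: zendP. Qed.
Lemma zend_mul1 : left_id zend_one zend_mul.
Proof. by move=> f; apply: zendP. Qed.
Lemma zend_mulr1 : right_id zend_one zend_mul.
Proof. by move=> f; apply: zendP. Qed.
Lemma zend_mulDl : left_distributive zend_mul +%R.
Proof. by move=> f g h; apply: zendP. Qed.
Lemma zend_mulDr : right_distributive zend_mul +%R.
Proof. by move=> f g h; apply: zendP => v /=; rewrite raddfD. Qed.

HB.instance Definition _ := GRing.Zmodule_isPzRing.Build (zend V)
  zend_mulA zend_mul1 zend_mulr1 zend_mulDl zend_mulDr.

End AdditiveEndomorphisms.

(* The ring of module endomorphisms of [V], multiplied by composition. *)
Definition lend (R : nzRingType) (V : lmodType R) := {linear V -> V}.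

Section LinearEndomorphisms.
Variables (R : nzRingType) (V : lmodType R).
Implicit Types f g h : lend V.

HB.instance Definition _ := gen_eqMixin (lend V).
HB.instance Definition _ := gen_choiceMixin (lend V).

Lemma lendP f g : f =1 g -> f = g.
Proof.
case: f g => f [[cf] [sf]] [g [[cg] [sg]]] /= /funext fg; subst g.
by rewrite (Prop_irrelevance cf cg) (Prop_irrelevance sf sg).
Qed.

Definition lend_zero : lend V := \0.
Definition lend_opp f : lend V := \- f.
Definition lend_add f g : lend V := f \+ g.
Definition lend_one : lend V := idfun.
Definition lend_mul f g : lend V := f \o g.

Lemma lend_addA : associative lend_add.
Proof. by move=> f g h; apply: lendP => v /=; rewrite addrA. Qed.
Lemma lend_addC : commutative lend_add.
Proof. by move=> f g; apply: lendP => v /=; rewrite addrC. Qed.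
Lemma lend_add0 : left_id lend_zero lend_add.
Proof. by move=> f; apply: lendP => v /=; rewrite add0r. Qed.
Lemma lend_addN : left_inverse lend_zero lend_opp lend_add.
Proof. by move=> f; apply: lendP => v /=; rewrite addNr. Qed.

HB.instance Definition _ := GRing.isZmodule.Build (lend V)
  lend_addA lend_addC lend_add0 lend_addN.

Lemma lend_mulA : associative lend_mul.
Proof. by move=> f g h; apply: lendP. Qed.
Lemma lend_mul1 : left_id lend_one lend_mul.
Proof. by move=> f; apply: lendP. Qed.
Lemma lend_mulr1 : right_id lend_one lend_mul.
Proof. by move=> f; apply: lendP. Qed.
Lemma lend_mulDl : left_distributive lend_mul +%R.
Proof. by move=> f g h; apply: lendP. Qed.
Lemma lend_mulDr : right_distributive lend_mul +%R.
Proof. by move=> f g h; apply: lendP => v /=; rewrite raddfD. Qed.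

HB.instance Definition _ := GRing.Zmodule_isPzRing.Build (lend V)
  lend_mulA lend_mul1 lend_mulr1 lend_mulDl lend_mulDr.

Definition zend_of (f : lend V) : zend V := f.

(* A right vector space over [D] is a [lmodType D^c]; then [scal V d] is the
   right action [v |-> v d], and [(v d) e = v (d e)] makes [scal V] a ring
   morphism [D -> (zend V)^c] or, equivalently, [D^c -> zend V]. *)
Definition scal (d : R) : zend V := *:%R d.

End LinearEndomorphisms.

Section Subspaces.
Variables (R : nzRingType) (V : lmodType R).
Implicit Types (W : set V) (x : lend V).

Definition subspace W : Prop := GRing.submod_closed (mem W).

Definition is_basis n (b : 'I_n -> V) W : Prop :=
  (forall i, W (b i)) /\
  (forall v, W v -> exists! c : {ffun 'I_n -> R}, v = \sum_(i < n) c i *: b i).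

Definition finite_dimensional W : Prop :=
  exists n (b : 'I_n -> V), is_basis b W.

(* [n]-dimensional x-basic subspaces; the basis is indexed from 0. *)
Definition basic_of_dim x W n : Prop :=
  [/\ subspace W, set_fun W W x, exists2 v, W v & v != 0 &
    exists b : 'I_n -> V,
      [/\ is_basis b W,
          forall h h' : 'I_n, h' = h.+1 :> nat -> x (b h) = b h' &
          forall h : 'I_n, h.+1 = n -> x (b h) = 0]].

Definition direct_sum_decomposition (I : choiceType) (W : I -> set V) : Prop :=
  (forall i, subspace (W i)) /\
  (forall v, exists! w : {fsfun I -> V with 0},
     (forall i, W i (w i)) /\ v = \sum_(i <- finsupp w) w i).

End Subspaces.

Definition generated_subring (E : pzRingType) (A : set E) : set E :=
  smallest (fun S : set E => GRing.subring_closed (mem S)) A.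

Definition subalgebra_closed (R : nzRingType) (V : lmodType R)
    (S : set (zend V)) : Prop :=
  GRing.subring_closed (mem S) /\
  forall (d : R) (f : zend V), S f -> S (scal V d * f).

Definition generated_subalgebra (R : nzRingType) (V : lmodType R)
    (A : set (zend V)) : set (zend V) :=
  smallest (@subalgebra_closed R V) A.

(* The subring of [E] generated by [range a], [x] and [y] is isomorphic to the
   monoid ring [{malg R[monF]}], compatibly with the generators.  For a right
   [D]-space [V] this applies to [R := D], [E := (zend V)^c] (endomorphisms
   composed on the side on which [D] acts) and to [R := D^c], [E := zend V]
   (usual composition); the relations of [monF] are symmetric under reversal of
   words, so that [monF] does not change when passing from one to the other. *)
Definition generate_monoid_ring (R : nzRingType) (E : pzRingType)
    (a : R -> E) (x y : E) : Prop :=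
  exists phi : {rmorphism {malg R[monF]} -> E},
    [/\ injective phi,
        forall d : R, phi d%:MP = a d,
        phi << F_x >> = x,
        phi << F_y >> = y &
        range phi = generated_subring (range a `|` [set x; y])].

(* Meant for commutative [D]; the order of composition is then immaterial for the
   scalars. *)
Definition generate_monoid_algebra (D : unitRingType) (V : lmodType D^c)
    (x y : zend V) : Prop :=
  exists phi : {rmorphism {malg D[monF]} -> zend V},
    [/\ injective phi,
        forall (d : D) (p : {malg D[monF]}), phi (d *: p) = scal V d * phi p,
        phi << F_x >> = x,
        phi << F_y >> = y &
        range phi = generated_subalgebra [set x; y]].

(* Main.v *)
Require Import Defs.
From HB Require Import structures.
From mathcomp Require Import all_boot all_order all_algebra.
From mathcomp Require Import zify.
From mathcomp Require Import finmap boolp classical_sets functions.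
From mathcomp.multinomials Require Import monalg.

Set Implicit Arguments.
Unset Strict Implicit.
Unset Printing Implicit Defensive.

Import GRing.Theory.
Local Open Scope ring_scope.
Local Open Scope classical_set_scope.

(** A strong inner inverse is built on each summand and the pieces are glued.
   On a summand where [x] is injective a left inverse works, and where [x] is
   surjective a right inverse works.  On a finite-dimensional summand, the only
   remaining obstruction is nilpotent: where a basis is a union of finite
   strings along which [x] shifts upwards, the downward shift [y] is a strong
   inner inverse, because both sides of each defining relation move the [l]-th
   vector of a string of indices [0, ..., n] to the same place, for the same
   [l] ([shift_string_sii]).

   Injective and finite-dimensional summands are treated together, under the
   hypothesis that the kernels of the powers of [x] stop growing at some
   exponent ([local_sii_stable]).  By induction on that exponent, the Jordan
   blocks of maximal size are split off, all at once, as an [x]-invariant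
   direct summand.  All splittings are idempotents, obtained from the fact that
   over a division ring the endomorphism ring of a vector space is von Neumann
   regular ([lend_regular]), which is where a maximality argument enters.

   For the second half, every word in the generators reduces by the relations
   to some [x^i y^j x^k] with [i, k <= j] ([normal_word_exists]).  A basic
   summand of dimension [n + 1] contains, for any strong inner inverse [y] that
   preserves it, a string of [n + 1] vectors shifted up by [x] and down by [y]:
   the powers of [x] applied to [y^n x^n b], for [b] the first basis vector
   ([basic_shift_string]).  Hence the [y] of the first half already serves.
   On such a string the word [x^i y^j x^k] is defined on the vectors of indices
   [j - k, ..., n - k] and shifts them by [i - j + k].  Evaluating a
   linear combination of normal words where exactly one chosen word survives
   shows that the words are independent over the scalars
   ([words_independent]), so the monoid ring acts faithfully. *)

(** * Endomorphisms acting on vectors *)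

Section Action.
Variables (R : nzRingType) (V : lmodType R).
Implicit Types (e f g x y : lend V) (v w : V) (W : set V).

Lemma lendM f g v : (f * g) v = f (g v). Proof. by []. Qed.
Lemma lendD f g v : (f + g) v = f v + g v. Proof. by []. Qed.
Lemma lendN f v : (- f) v = - f v. Proof. by []. Qed.
Lemma lend1 v : (1 : lend V) v = v. Proof. by []. Qed.
Lemma lend0 v : (0 : lend V) v = 0. Proof. by []. Qed.
Lemma lendXS f n v : (f ^+ n.+1) v = f ((f ^+ n) v).
Proof. by rewrite exprS. Qed.
Lemma lendXSr f n v : (f ^+ n.+1) v = (f ^+ n) (f v).
Proof. by rewrite exprSr. Qed.
Lemma lendXD f m n v : (f ^+ (m + n)) v = (f ^+ m) ((f ^+ n) v).
Proof. by rewrite exprD. Qed.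
Definition lendE := (lendM, lendD, lendN, lend1, lend0).

Lemma lend_sum (J : Type) (r : seq J) (P : pred J) (F : J -> lend V) v :
  (\sum_(l <- r | P l) F l) v = \sum_(l <- r | P l) F l v.
Proof. by elim/big_rec2: _ => // l f w _ <-. Qed.

Definition lend_of_linear (f : V -> V) (lf : linear f) : lend V :=
  HB.pack f (GRing.isLinear.Build R V V *:%R f lf).

(** Testing the relations on the vectors of [W] only makes it possible to verify
   them separately on the pieces of a decomposition. *)
Definition sii_on W x y : Prop :=
  forall i j k : nat, (i <= j)%N -> (k <= j)%N -> forall v, W v ->
    (x ^+ i) ((y ^+ j) ((x ^+ k) v)) = (y ^+ (j - i)) ((x ^+ j) ((y ^+ (j - k)) v)).

Lemma set_fun_exp W f n : set_fun W W f -> set_fun W W (f ^+ n).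
Proof.
move=> fW; elim: n => [|n IH] v Wv; first by rewrite expr0.
by rewrite lendXS; apply/fW/IH.
Qed.

Lemma exp_inverse_on W f g m n : set_fun W W f -> set_fun W W g ->
    (forall v, W v -> f (g v) = v) -> (n <= m)%N ->
  forall v, W v -> (f ^+ m) ((g ^+ n) v) = (f ^+ (m - n)) v.
Proof.
move=> fW gW fgK; elim: n m => [|n IH] m lenm v Wv; first by rewrite subn0.
case: m lenm => // m lenm; rewrite lendXSr lendXS fgK ?IH //.
exact: set_fun_exp.
Qed.

Lemma sii_on_left_inverse W x y : set_fun W W x -> set_fun W W y ->
  (forall v, W v -> y (x v) = v) -> sii_on W x y.
Proof.
move=> xW yW yxK i j k ij kj v Wv; rewrite (exp_inverse_on yW xW) //.
rewrite -[X in _ = (y ^+ _) ((x ^+ X) _)](subnK ij) lendXD.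
rewrite (exp_inverse_on yW xW) ?subnn //.
by apply: set_fun_exp => //; apply: set_fun_exp.
Qed.

Lemma sii_on_right_inverse W x y : set_fun W W x -> set_fun W W y ->
  (forall v, W v -> x (y v) = v) -> sii_on W x y.
Proof.
move=> xW yW xyK i j k ij kj v Wv.
rewrite (exp_inverse_on (m := j) xW yW) ?leq_subr // subKn //.
rewrite -[X in (y ^+ X)](subnKC ij) lendXD.
rewrite (exp_inverse_on xW yW) ?subnn //.
by apply: set_fun_exp => //; apply: set_fun_exp.
Qed.

Lemma subspaceP W :
  subspace W <-> W 0 /\ forall a v w, W v -> W w -> W (a *: v + w).
Proof.
split=> [[W0 WD]|[W0 WD]]; split.
- exact: set_mem.
- by move=> a v w Wv Ww; apply/set_mem/WD; apply: mem_set.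
- exact: mem_set.
- by move=> a v w /set_mem Wv /set_mem Ww; apply/mem_set/WD.
Qed.

Lemma subspaceD W v w : subspace W -> W v -> W w -> W (v + w).
Proof. by move=> /subspaceP[_ WD] Wv Ww; rewrite -[v]scale1r; apply: WD. Qed.

Lemma subspaceZ W a v : subspace W -> W v -> W (a *: v).
Proof. by move=> /subspaceP[W0 WD] Wv; rewrite -[_ *: _]addr0; apply: WD. Qed.

Lemma subspaceB W v w : subspace W -> W v -> W w -> W (v - w).
Proof.
move=> sW Wv Ww; rewrite -scaleN1r.
by apply: subspaceD => //; apply: subspaceZ.
Qed.

End Action.

(** * Von Neumann regularity of the endomorphism ring *)

Section Regular.
Variables (R : unitRingType) (divR : GRing.field_axiom R) (V : lmodType R).
Implicit Types (f g : lend V) (v w : V) (W K S : set V).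

(** A subspace [K] maximal among those meeting [S] trivially is a complement: if
   [v] were not in [K + S], then [K] and [v] together would span a larger
   subspace still meeting [S] trivially, because in a relation [a v + k] in [S]
   a nonzero [a] could be cancelled. *)
Lemma complement_exists S : subspace S ->
  exists K, [/\ subspace K, forall v, K v -> S v -> v = 0 &
                forall v, exists2 k, K k & S (v - k)].
Proof.
(* Not asking that [K] contain 0 lets the empty union satisfy [P]. *)
move=> sS; pose P K := (forall a v w, K v -> K w -> K (a *: v + w)) /\
                       (forall v, K v -> S v -> v = 0).
have [|K [[KD KS] Kmax]] := @Zorn_bigcup V P.
  move=> F FP Ftot; split=> [a v w [A FA Av] [B FB Bw]|v [A FA Av]].
    have [AB|BA] := Ftot A B FA FB.
      by exists B => //; apply: (FP B FB).1 => //; apply: AB.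
    by exists A => //; apply: (FP A FA).1 => //; apply: BA.
  exact: (FP A FA).2.
have K0 : K 0.
  apply: contrapT => nK0; apply: (Kmax (K `|` [set 0])).
    by split=> [|KU]; [exact: subsetUl | apply/nK0/KU; right].
  split=> [a v w [Kv|->] [Kw|->]|v [Kv|->] //]; last exact: KS.
  - by left; apply: KD.
  - by case: nK0; rewrite -(addNr v) -scaleN1r; apply: KD.
  - by rewrite scaler0 add0r; left.
  - by rewrite scaler0 add0r; right.
have sK : subspace K by apply/subspaceP.
exists K; split=> // v; apply: contrapT => nKv.
have nv : ~ K v by move=> Kv; apply: nKv; exists v; rewrite ?subrr //; case/subspaceP: sS.
apply: (Kmax [set w | exists a k, K k /\ w = a *: v + k]).
  split=> [w Kw|sub]; first by exists 0, w; rewrite scale0r add0r.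
  by apply/nv/sub; exists 1, 0; rewrite scale1r addr0.
split=> [a _ _ [b [k [Kk ->]]] [c [l [Kl ->]]]|w [a [k [Kk wE]]] Sw].
  exists (a * b + c), (a *: k + l); split; first exact: KD.
  by rewrite scalerDr scalerA scalerDl addrACA.
have [a0|/divR Ua] := eqVneq a 0.
  by apply: KS => //; rewrite wE a0 scale0r add0r.
case: nKv; exists (- (a^-1 *: k)).
  by rewrite -scaleNr; apply: subspaceZ.
suff -> : v - - (a^-1 *: k) = a^-1 *: w by apply: subspaceZ.
by rewrite wE opprK scalerDr scalerA mulVr // scale1r.
Qed.

(** [f] maps a complement [K] of its kernel isomorphically onto its image; [g]
   inverts this isomorphism and vanishes on a complement [L] of the image. *)
Lemma lend_regular f : exists g, forall v, f (g (f v)) = f v.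
Proof.
have [] := @complement_exists [set v | f v = 0].
  apply/subspaceP; split=> [|a v w fv fw] /=; first by rewrite linear0.
  by rewrite linearP fv fw scaler0 addr0.
move=> K [sK Kker KD].
have [] := @complement_exists (range f).
  apply/subspaceP; split=> [|a _ _ [v _ <-] [w _ <-]].
    by exists 0; rewrite ?linear0.
  by exists (a *: v + w); rewrite ?linearP.
move=> L [sL Lim LD].
have ex v : exists k, K k /\ L (v - f k).
  have [l Ll [u _ fu]] := LD v; have [k Kk fuk] := KD u.
  exists k; split=> //; suff -> : v - f k = l by [].
  by apply/eqP; rewrite subr_eq addrC -subr_eq -fu -subr_eq0 -linearB; apply/eqP.
have [g gP] := choice ex.
have g_uniq v k : K k -> L (v - f k) -> g v = k.
  move=> Kk Lk; have [Kg Lg] := gP v; apply/eqP; rewrite -subr_eq0; apply/eqP.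
  apply: Kker; first exact: subspaceB.
  apply: (Lim (f (g v - k))); last by exists (g v - k).
  suff -> : f (g v - k) = (v - f k) - (v - f (g v)) by apply: subspaceB.
  by rewrite linearB /= opprB [RHS]addrC addrA addrNK.
have lin_g : linear g.
  move=> a v w; have [[Kv Lv] [Kw Lw]] := (gP v, gP w).
  apply: g_uniq; first by apply: subspaceD => //; apply: subspaceZ.
  rewrite linearP opprD addrACA -scalerBr.
  by apply: subspaceD => //; apply: subspaceZ.
exists (lend_of_linear lin_g) => v /=.
have [Kg Lg] := gP (f v); apply/esym/eqP; rewrite -subr_eq0; apply/eqP/Lim => //.
by exists (v - g (f v)); rewrite ?linearB.
Qed.

Lemma kernel_projection f : exists k : lend V,
  (forall v, f (k v) = 0) /\ (forall v, f v = 0 -> k v = v).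
Proof.
have [g fgf] := lend_regular f; exists (1 - g * f).
by split=> [v|v fv]; rewrite !lendE ?fv ?linear0 ?addr0 // linearB /= fgf subrr.
Qed.

(** Two images that meet trivially can be separated: [s t] is the identity on the
   image of [s] and zero on that of [a].  If [g] is an inner inverse of [s] and
   [h] one of [(1 - s g) a], then [s g] projects onto the image of [s], and
   subtracting [s g a h (1 - s g)] corrects its values on the image of [a]. *)
Lemma separating_projection (s a : lend V) :
    (forall v w, s v = a w -> a w = 0) ->
  exists t : lend V, (forall v, s (t (s v)) = s v) /\ (forall v, s (t (a v)) = 0).
Proof.
move=> sa; have [g sgs] := lend_regular s.
have [h] := lend_regular ((1 - s * g) * a); move=> hP.
exists (g * (1 - a * h * (1 - s * g))); split=> v; rewrite !lendE.
  by rewrite !sgs subrr !linear0 addr0 sgs.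
have {hP} := hP v; rewrite !lendE.
set w := h _ => hw.
have E : s (g (a (v - w))) = a (v - w).
  rewrite (linearB a) (linearB g) (linearB s) /=.
  by apply/eqP; rewrite eq_sym subr_eq addrAC -addrA [eqbRHS]addrC -subr_eq -hw.
by rewrite -linearB -/(a _) E (sa _ _ E).
Qed.

End Regular.

(** * Strings of vectors shifted up and down, and Jordan blocks *)

Section Blocks.
Variables (R : nzRingType) (V : lmodType R).
Implicit Types (x y : lend V) (v t : V).

(** The vectors [t, x t, ..., x^n t] are shifted up by [x] and down by [y]; a
   proper string is obtained when [x^n t] is nonzero, which already follows from
   [t != 0]. *)
Definition shift_string n x y t : Prop :=
  [/\ (x ^+ n.+1) t = 0, y t = 0 &
      forall l, (l < n)%N -> y ((x ^+ l.+1) t) = (x ^+ l) t].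

Lemma exp_kill x t m n : (x ^+ m) t = 0 -> (m <= n)%N -> (x ^+ n) t = 0.
Proof. by move=> xt le_mn; rewrite -(subnK le_mn) lendXD xt linear0. Qed.

Lemma shift_string_down n x y t m l : shift_string n x y t -> (l <= n)%N ->
  (y ^+ m) ((x ^+ l) t) = if (m <= l)%N then (x ^+ (l - m)) t else 0.
Proof.
move=> [_ yt yx] len; elim: m => [|m IH]; first by rewrite subn0.
rewrite lendXS IH; have [ml|lm] := leqP m l; last first.
  by rewrite /= linear0 ltnNge ltnW.
have [m_lt_l|] := ltnP m l; last by rewrite -subn_eq0 => /eqP->.
by rewrite -(subnSK m_lt_l) yx //; lia.
Qed.

Lemma shift_string_word n x y t i j k l : shift_string n x y t -> (l <= n)%N ->
  (x ^+ i) ((y ^+ j) ((x ^+ k) ((x ^+ l) t))) =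
  if (j <= k + l <= n)%N then (x ^+ (i + (k + l - j))) t else 0.
Proof.
move=> st len; rewrite -lendXD; have [kln|nkl] := leqP (k + l) n; last first.
  by case: st => xt _ _; rewrite (exp_kill xt) // !linear0 andbF.
by rewrite (shift_string_down _ st) // andbT; case: leqP; rewrite ?linear0 // -lendXD.
Qed.

(** Both sides of the relation send [x^l t] to [x^(l + k - j + i) t] when
   [j - k <= l <= n - k], and to 0 otherwise. *)
Lemma shift_string_sii n x y t l : shift_string n x y t -> (l <= n)%N ->
  sii_on [set (x ^+ l) t] x y.
Proof.
move=> st len i j k ij kj _ ->; rewrite (shift_string_word _ _ _ st) //.
rewrite (shift_string_down _ st) //.
have [jkl|ljk] := leqP (j - k) l; last by rewrite !linear0 leqNgt; case: leqP => //; lia.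
rewrite -lendXD; have -> : (j + (l - (j - k)) = k + l)%N by lia.
have [kln|nkl] := leqP (k + l) n; last first.
  by case: st => xt _ _; rewrite (@exp_kill _ _ n.+1 (k + l)) // linear0 andbF.
rewrite (shift_string_down _ st) //= andbT !ifT; [|lia..].
by have -> : (k + l - (j - i) = i + (k + l - j))%N by lia.
Qed.

Lemma sum_delta N m (F : nat -> V) : (m < N)%N ->
  \sum_(l < N) (if l == m :> nat then F l else 0) = F m.
Proof.
move=> mN; rewrite -big_mkcond (bigD1 (Ordinal mN)) //= big1 ?addr0 // => l.
by case/andP=> /eqP lm /eqP[]; apply: val_inj.
Qed.

(** With [m = 0], the endomorphisms [x^a tau x^(n - b)] for [a, b <= n] are matrix
   units [E_ab], so that [tau] is [E_0n] and its image generates a sum of Jordan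
   blocks of size [n + 1].  For larger [m] only part of the orthogonality
   relations is required, the others being achieved step by step. *)
Definition block_from m n x (tau : lend V) : Prop :=
  [/\ forall i v, (m <= i <= n)%N ->
        tau ((x ^+ i) (tau v)) = if i == n then tau v else 0,
      forall v, (x ^+ n.+1) (tau v) = 0 & forall v, tau ((x ^+ n.+1) v) = 0].

Definition block := block_from 0.

(** The sum of the diagonal matrix units [E_ll], hence a projection. *)
Definition block_proj n x (tau : lend V) : lend V :=
  \sum_(l < n.+1) x ^+ l * tau * x ^+ (n - l).

(** The sum of the matrix units [E_(l, l+1)], the downward shift. *)
Definition block_shift n x (tau : lend V) : lend V :=
  \sum_(l < n) x ^+ l * tau * x ^+ (n.-1 - l).

Section Block.
Variables (n : nat) (x tau : lend V).
Hypothesis blk : block n x tau.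
Let c := block_proj n x tau.
Let y := block_shift n x tau.

Lemma blockE i v : tau ((x ^+ i) (tau v)) = if i == n then tau v else 0.
Proof.
case: blk => b1 b2 _; have [/b1//|ni] := leqP i n.
by rewrite gtn_eqF // (exp_kill (b2 v) ni) linear0.
Qed.

Lemma block_projE v : c v = \sum_(l < n.+1) (x ^+ l) (tau ((x ^+ (n - l)) v)).
Proof. exact: lend_sum. Qed.

Lemma block_shiftE v : y v = \sum_(l < n) (x ^+ l) (tau ((x ^+ (n.-1 - l)) v)).
Proof. exact: lend_sum. Qed.

Lemma block_shift_string v : shift_string n x y (tau v).
Proof.
have [_ b2 _] := blk; split=> //.
  rewrite block_shiftE big1 // => l _; rewrite blockE ifF ?linear0 //.
  by have := ltn_ord l; lia.
move=> l ln; rewrite block_shiftE -[RHS](sum_delta (fun l => (x ^+ l) (tau v)) ln).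
apply: eq_bigr => i _; rewrite -lendXD blockE.
have -> : (n.-1 - i + l.+1 == n)%N = (i == l :> nat) by have := ltn_ord i; lia.
by case: eqP; rewrite ?linear0.
Qed.

Lemma block_proj_shift_string l v : (l <= n)%N -> c ((x ^+ l) (tau v)) = (x ^+ l) (tau v).
Proof.
rewrite -ltnS => ln; rewrite block_projE -[RHS](sum_delta (fun l => (x ^+ l) (tau v)) ln).
apply: eq_bigr => i _; rewrite -lendXD blockE.
have -> : (n - i + l == n)%N = (i == l :> nat) by have := ltn_ord i; lia.
by case: eqP; rewrite ?linear0.
Qed.

Lemma block_proj_idem v : c (c v) = c v.
Proof.
rewrite [in RHS]block_projE [X in c X]block_projE linear_sum.
by apply: eq_bigr => l _; rewrite /= block_proj_shift_string // -ltnS.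
Qed.

(** The two sums of terms [x^(l + 1) tau x^(n - l)] agree after an index shift,
   except for end terms that contain [x^(n + 1)] and vanish. *)
Lemma block_proj_comm v : x (c v) = c (x v).
Proof.
have [_ b2 b3] := blk; rewrite !block_projE linear_sum /=.
rewrite big_ord_recr [RHS]big_ord_recl /= -!lendXS -!lendXSr b2 subn0 b3.
rewrite addr0 add0r; apply: eq_bigr => l _.
by rewrite -lendXS -lendXSr /bump /= add1n subnSK.
Qed.

Lemma block_proj_shift v : c (y v) = y v.
Proof.
rewrite block_shiftE linear_sum; apply: eq_bigr => l _.
by rewrite /= block_proj_shift_string // ltnW.
Qed.

Lemma block_shift_proj v : y (c v) = y v.
Proof.
rewrite [in LHS]block_projE linear_sum big_ord_recl /=.
have yt u : y (tau u) = 0 by case: (block_shift_string u).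
rewrite yt add0r block_shiftE; apply: eq_bigr => l _ /=; rewrite /bump /= add1n.
have [_ _ yx] := block_shift_string ((x ^+ (n - l.+1)) v); rewrite yx //.
by have -> : (n - l.+1 = n.-1 - l)%N by lia.
Qed.

Lemma block_sii : sii_on (range c) x y.
Proof.
move=> i j k ij kj _ [v _ <-]; rewrite block_projE !linear_sum /=.
apply: eq_bigr => l _; apply: (shift_string_sii (block_shift_string _) _ ij kj erefl).
by rewrite -ltnS.
Qed.

Lemma block_tau_proj v : tau (c v) = tau v.
Proof.
rewrite block_projE linear_sum -[v in RHS]/((x ^+ 0) v) -[in RHS](subnn n) /=.
rewrite -[RHS](sum_delta (fun l => tau ((x ^+ (n - l)) v)) (ltnSn n)).
by apply: eq_bigr => l _; rewrite blockE.
Qed.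

End Block.
End Blocks.

(** * Strong inner inverses on a direct summand *)

Section Splitting.
Variables (R : nzRingType) (V : lmodType R).
Implicit Types (e x y : lend V) (v : V) (W : set V).

(** [e] is meant to be an idempotent commuting with [x], and [range e] the
   summand on which a strong inner inverse is sought; [y] is extended by 0 along
   the kernel of [e]. *)
Definition local_sii e x : Prop :=
  exists y : lend V, [/\ forall v, e (y v) = y v, forall v, y (e v) = y v &
                         sii_on (range e) x y].

Lemma sii_on_ext W x y y' : set_fun W W x -> set_fun W W y' ->
  (forall v, W v -> y v = y' v) -> sii_on W x y' -> sii_on W x y.
Proof.
move=> xW yW yy' sii i j k ij kj v Wv.
have yXE n : forall v, W v -> (y ^+ n) v = (y' ^+ n) v.
  elim: n => [//|n IH] w Ww; rewrite !lendXS IH // yy' //.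
  exact: (set_fun_exp n yW).
have Wx n w : W w -> W ((x ^+ n) w) := @set_fun_exp _ _ W x n xW w.
have Wy n w : W w -> W ((y' ^+ n) w) := @set_fun_exp _ _ W y' n yW w.
by rewrite !yXE ?sii //; [apply/Wx/Wy|apply: Wx].
Qed.

Lemma set_fun_range e f : (forall v, f (e v) = e (f v)) ->
  set_fun (range e) (range e) f.
Proof. by move=> fe _ [v _ <-]; exists (f v). Qed.

Lemma comm_exp e x n : (forall v, x (e v) = e (x v)) ->
  forall v, (x ^+ n) (e v) = e ((x ^+ n) v).
Proof. by move=> xe; elim: n => [//|n IH] v; rewrite !lendXS IH. Qed.

(** The last condition says that the block reaches every vector of the form
   [x^n u] killed by [x], with [u] in the range of [e].  Then on the complement
   of the block [x^n] kills all that [x^(n + 1)] kills. *)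
Definition exhausts_top_layer e n x (tau : lend V) : Prop :=
  [/\ forall v, e (tau v) = tau v, forall v, tau (e v) = tau v &
    forall v, (x ^+ n.+1) (e v) = 0 ->
      (x ^+ n) (tau ((x ^+ n) (e v))) = (x ^+ n) (e v)].

(** A Gram-Schmidt step: subtracting [x^(n - m) tau x^m tau] from [tau] makes
   [tau x^m tau] vanish, as [tau x^n tau = tau].  The correction has a positive
   power of [x] on its left, so it is invisible to the relations with larger
   exponents and to the top layer. *)
Lemma block_from_down e m n x tau : (forall v, x (e v) = e (x v)) ->
    (m < n)%N -> block_from m.+1 n x tau -> exhausts_top_layer e n x tau ->
  exists tau', block_from m n x tau' /\ exhausts_top_layer e n x tau'.
Proof.
move=> xe mn [b1 b2 b3] [et te top].
have b0 i v : (m < i)%N -> tau ((x ^+ i) (tau v)) = if i == n then tau v else 0.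
  move=> mi; have [ni|ni] := leqP i n; first by apply: b1; rewrite mi.
  by rewrite gtn_eqF // (exp_kill (b2 v)) ?linear0.
pose tau' := tau - x ^+ (n - m) * tau * x ^+ m * tau.
have tE v : tau' v = tau v - (x ^+ (n - m)) (tau ((x ^+ m) (tau v))) by [].
exists tau'; split; split.
- move=> i v /andP[mi ni].
  have tt : tau ((x ^+ i) (tau' v)) = if i == n then tau v else 0.
    rewrite tE !linearB /= -lendXD (b0 (i + _)%N); last by lia.
    have [->|mi'] := eqVneq i m.
      by rewrite (subnKC (ltnW mn)) eqxx subrr ltn_eqF.
    rewrite (b0 i); last by lia.
    have -> : (i + (n - m) == n)%N = false by lia.
    by rewrite subr0.
  rewrite tE tt; by case: eqP => // _; rewrite !linear0 addr0.
- move=> v; rewrite tE linearB /= b2 -lendXD.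
  by rewrite (exp_kill (b2 _)) ?subr0 //; lia.
- by move=> v; rewrite tE b3 !linear0 addr0.
- by move=> v; rewrite tE (linearB e) /= et -(comm_exp (n - m) xe) et.
- by move=> v; rewrite tE te.
- move=> v xv; rewrite tE linearB /= top // -lendXD.
  by rewrite (exp_kill (b2 _)) ?subr0 //; lia.
Qed.

Lemma block_from_block e n x tau : (forall v, x (e v) = e (x v)) ->
    block_from n n x tau -> exhausts_top_layer e n x tau ->
  exists tau', block n x tau' /\ exhausts_top_layer e n x tau'.
Proof.
move=> xe b top; suff: forall d, (d <= n)%N -> exists tau',
    block_from (n - d) n x tau' /\ exhausts_top_layer e n x tau'.
  by move=> /(_ n (leqnn n)); rewrite subnn.
elim=> [|d IH] dn; first by exists tau; rewrite subn0.
have [tau1 [b1 top1]] := IH (ltnW dn).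
rewrite -(subnSK dn) in b1; apply: block_from_down b1 top1 => //; lia.
Qed.

Lemma block_proj_corner e n x tau v : (forall v, x (e v) = e (x v)) ->
    exhausts_top_layer e n x tau ->
  e (block_proj n x tau v) = block_proj n x tau v /\
  block_proj n x tau (e v) = block_proj n x tau v.
Proof.
move=> xe [et te _]; rewrite !block_projE linear_sum.
split; apply: eq_bigr => l _ /=; first by rewrite -(comm_exp _ xe) et.
by rewrite (comm_exp _ xe) te.
Qed.

(** The downward shift on the block and any strong inner inverse on its
   complement add up to a strong inner inverse. *)
Lemma split_local_sii e n x tau : (forall v, e (e v) = e v) ->
    (forall v, x (e v) = e (x v)) -> block n x tau -> exhausts_top_layer e n x tau ->
    let e' := e - block_proj n x tau in
    (forall v, x (e' v) = e' (x v)) -> local_sii e' x -> local_sii e x.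
Proof.
move=> ee xe b top e' xe' [y' [ey' ye' siiy']].
pose c := block_proj n x tau; pose y := block_shift n x tau.
have e'E v : e' v = e v - c v by [].
have [ec ce] : (forall v, e (c v) = c v) /\ (forall v, c (e v) = c v).
  by split=> v; have [] := block_proj_corner v xe top.
have cc := block_proj_idem b.
have ey v : e (y v) = y v by rewrite -(block_proj_shift b) ec.
have ye v : y (e v) = y v by rewrite -(block_shift_proj b) ce (block_shift_proj b).
have ee' v : e (e' v) = e' v by rewrite e'E linearB /= ee ec.
have e'e v : e' (e v) = e' v by rewrite !e'E ee ce.
have ce' v : c (e' v) = 0 by rewrite e'E linearB /= ce cc subrr.
have e'c v : e' (c v) = 0 by rewrite e'E ec cc subrr.
exists (y' + y); split=> [v|v|].
- by rewrite lendD linearD /= ey -[y' v]ey' ee'.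
- by rewrite !lendD ye -ye' e'e ye'.
have sii' : sii_on (range e') x (y' + y).
  apply: sii_on_ext siiy'; first exact: set_fun_range.
    by apply: set_fun_range => v; rewrite ye' ey'.
  move=> _ [v _ <-]; rewrite lendD -[y _](block_shift_proj b) ce'.
  by rewrite linear0 addr0.
have siic : sii_on (range c) x (y' + y).
  apply: sii_on_ext (block_sii b).
  - by apply: set_fun_range => v; rewrite block_proj_comm.
  - by apply: set_fun_range => v; rewrite block_shift_proj ?block_proj_shift.
  - by move=> _ [v _ <-]; rewrite lendD -[y' _]ye' e'c linear0 add0r.
move=> i j k ij kj _ [v _ <-]; have -> : e v = e' v + c v by rewrite e'E subrK.
have Re' : range e' (e' v) by exists v.
have Rc : range c (c v) by exists v.
move: (e' v) (c v) Re' Rc => u w Ru Rw.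
by rewrite !linearD /= (sii' _ _ _ ij kj _ Ru) (siic _ _ _ ij kj _ Rw).
Qed.

End Splitting.

Section LocalExistence.
Variables (R : unitRingType) (divR : GRing.field_axiom R) (V : lmodType R).
Implicit Types (e x y : lend V) (v : V) (W : set V).

(** Stability of the kernels at exponent [n + 1] says that the top layer, the
   image [x^n] of the kernel of [x^(n + 1)], meets the image of [x^(n + 1)]
   trivially.  A projection onto the former that kills the latter, lifted
   through [x^n], gives [tau]. *)
Lemma top_layer_block_exists e n x : (forall v, e (e v) = e v) ->
    (forall v, x (e v) = e (x v)) ->
    (forall v, (x ^+ n.+2) (e v) = 0 -> (x ^+ n.+1) (e v) = 0) ->
  exists tau, block_from n n x tau /\ exhausts_top_layer e n x tau.
Proof.
move=> ee xe stab; pose a := x ^+ n.+1 * e.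
have xne m v : (x ^+ m) (e v) = e ((x ^+ m) v) by apply: comm_exp.
(* [s] has the top layer as its image. *)
have [k0 [ak0 k0E]] := kernel_projection divR a.
pose s := x ^+ n * (e * k0).
have sE v : s v = (x ^+ n) (e (k0 v)) by [].
have xs v : x (s v) = 0 by rewrite sE -lendXS; apply: ak0.
have es v : e (s v) = s v by rewrite sE -xne ee.
have [t [sts sta]] : exists t : lend V, (forall v, s (t (s v)) = s v) /\
    (forall v, s (t (a v)) = 0).
  apply: separating_projection => // v w sa; apply: stab.
  by rewrite lendXS -[(x ^+ _) _]/(a w) -sa xs.
pose tau := e * k0 * t * s * t * e.
have tauE v : tau v = e (k0 (t (s (t (e v))))) by [].
have xtau v : (x ^+ n) (tau v) = s (t (e v)) by rewrite tauE -sE sts.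
exists tau; split; split.
- move=> i v; rewrite -eqn_leq => /eqP <-; rewrite eqxx xtau.
  by rewrite tauE es !sts.
- by move=> v; rewrite lendXS xtau xs.
- by move=> v; rewrite tauE -xne -[(x ^+ _) _]/(a v) sta !linear0.
- by move=> v; rewrite tauE ee.
- by move=> v; rewrite tauE ee.
- move=> v /k0E kv; have -> : (x ^+ n) (e v) = s v by rewrite sE kv.
  by rewrite xtau es sts.
Qed.

Lemma local_sii_surj e x : (forall v, e (e v) = e v) ->
  (forall v, x (e v) = e (x v)) ->
  set_surj (range e) (range e) x -> local_sii e x.
Proof.
move=> ee xe surj; have [g gP] := lend_regular divR (x * e).
exists (e * g * e); split=> [v|v|]; rewrite ?lendM ?ee //.
apply: sii_on_right_inverse; first exact: set_fun_range.
  by apply: set_fun_range => v; rewrite !lendM !ee.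
move=> _ [v _ <-]; have [_ [w _ <-] xw] : (x @` range e) (e v) by apply: surj; exists v.
by rewrite !lendM ee -xw; apply: gP.
Qed.

(** Injectivity is the case [n = 0], where a left inverse works.  In general, once
   the Jordan blocks of size [n + 1] are split off, a vector of the complement
   killed by [x^(n + 1)] is already killed by [x^n]: its image under [x^n] lies
   in the top layer, hence in the block. *)
Lemma local_sii_stable n e x : (forall v, e (e v) = e v) ->
    (forall v, x (e v) = e (x v)) ->
    (forall v, (x ^+ n.+1) (e v) = 0 -> (x ^+ n) (e v) = 0) ->
  local_sii e x.
Proof.
elim: n e => [|n IH] e ee xe stab.
  have [g gP] := lend_regular divR (x * e).
  exists (e * g * e); split=> [v|v|]; rewrite ?lendM ?ee //.
  apply: sii_on_left_inverse; first exact: set_fun_range.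
    by apply: set_fun_range => v; rewrite !lendM !ee.
  move=> _ [v _ <-]; rewrite !lendM -xe ee.
  apply/eqP; rewrite -subr_eq0 -(linearB e); apply/eqP.
  apply: stab; rewrite expr1 !linearB.
  by have := gP v; rewrite !lendM => /= ->; rewrite subrr.
have [tau0 [b0 top0]] := top_layer_block_exists ee xe stab.
have [tau [b top]] := block_from_block xe b0 top0.
have [et te topE] := top; have cc := block_proj_idem b.
have [ec ce] : (forall v, e (block_proj n x tau v) = block_proj n x tau v) /\
               (forall v, block_proj n x tau (e v) = block_proj n x tau v).
  by split=> v; have [] := block_proj_corner v xe top.
have xe' v : x ((e - block_proj n x tau) v) = (e - block_proj n x tau) (x v).
  by rewrite !lendD !lendN linearB /= xe (block_proj_comm b).
apply: (split_local_sii ee xe b top) => //.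
have e'E v : (e - block_proj n x tau) v = e v - block_proj n x tau v by [].
apply: IH => // v.
  by rewrite !e'E (linearB e) (linearB (block_proj _ _ _)) /= ee ec ce cc subrr subr0.
set u := _ v; have eu : e u = u by rewrite /u e'E linearB /= ee ec.
have cu : block_proj n x tau u = 0 by rewrite /u e'E linearB /= ce cc subrr.
move=> xu; rewrite -eu -topE eu //.
rewrite -(block_tau_proj b) -(comm_exp n (block_proj_comm b)).
by rewrite cu !linear0.
Qed.

End LocalExistence.

(** * Stabilization of kernels in finite dimension *)

Section FiniteDimensional.
Variables (R : unitRingType) (divR : GRing.field_axiom R) (V : lmodType R).
Implicit Types (e x y : lend V) (v u : V) (W : set V).

(** Gaussian elimination of one column: subtract multiples of a row [r] with a
   nonzero entry in the first column from the other rows. *)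
Lemma left_dependent n (A : 'I_n.+1 -> 'I_n -> R) :
  exists d : 'I_n.+1 -> R,
    (exists i, d i != 0) /\ forall j, \sum_i d i * A i j = 0.
Proof.
elim: n A => [|n IH] A.
  by exists (fun=> 1); split=> [|[]//]; exists ord0; apply: oner_neq0.
(* When the whole column vanishes, any row will do. *)
have [r rP] : exists r, forall i, A i ord0 / A r ord0 * A r ord0 = A i ord0.
  have [[r /divR Ur]|A0] := pselect (exists r, A r ord0 != 0).
    by exists r => i; rewrite divrK.
  have {}A0 i : A i ord0 = 0.
    by apply/eqP/negPn/negP => Ai; apply: A0; exists i.
  by exists ord0 => i; rewrite !A0 !mul0r.
have [d [[i di] dB]] := IH (fun i j => A (lift r i) (lift ord0 j) -
  A (lift r i) ord0 / A r ord0 * A r (lift ord0 j)).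
pose q := \sum_k d k * (A (lift r k) ord0 / A r ord0).
exists (fun k => if unlift r k is Some l then d l else - q); split.
  by exists (lift r i); rewrite liftK.
have sumE j : \sum_k (if unlift r k is Some l then d l else - q) * A k j =
    \sum_k d k * (A (lift r k) j - A (lift r k) ord0 / A r ord0 * A r j).
  rewrite (bigD1_ord r) //= unlift_none mulNr mulr_suml addrC -sumrB.
  by apply: eq_bigr => k _; rewrite [unlift _ _](liftK r k) mulrBr !mulrA.
move=> j; rewrite sumE; case: (unliftP ord0 j) => [l ->|->]; first exact: dB.
by rewrite big1 // => k _; rewrite rP subrr mulr0.
Qed.

(** In dimension [n], the [n + 1] vectors [u, x u, ..., x^n u] are dependent.  If
   [x^(n + 1) u = 0] and [i] is the least index of a nonzero coefficient, then
   applying [x^(n - i)] to the relation leaves a nonzero multiple of [x^n u]. *)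
Lemma finite_dimensional_stable W x : finite_dimensional W -> set_fun W W x ->
  exists n, forall v, W v -> (x ^+ n.+1) v = 0 -> (x ^+ n) v = 0.
Proof.
move=> [n [b [_ bW]]] xW; exists n => u Wu xu.
have Wxu i : W ((x ^+ i) u) by apply: (@set_fun_exp _ _ W x i xW u).
have {bW Wxu} [A AE] := choice (fun i => let: ex_intro c (conj cE _) := bW _ (Wxu i)
  in ex_intro (fun c : {ffun _ -> R} => _ = \sum_j c j *: b j) c cE).
have [d [[i di] dA]] := left_dependent (fun i : 'I_n.+1 => A i).
have dxu : \sum_i d i *: (x ^+ i) u = 0.
  under eq_bigr => k _ do rewrite AE scaler_sumr.
  rewrite exchange_big big1 //= => j _.
  by under eq_bigr => k _ do rewrite scalerA; rewrite -scaler_suml dA scale0r.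
case: (@arg_minnP _ i (fun k => d k != 0) (@nat_of_ord _) di) => {di} {}i di imin.
have := congr1 (x ^+ (n - i)) dxu; rewrite linear0 linear_sum (bigD1 i) //=.
rewrite big1 => [|k ki]; rewrite linearZ /= -lendXD; last first.
  have [dk|dk] := eqVneq (d k) 0; first by rewrite dk scale0r.
  rewrite (exp_kill xu) ?scaler0 //.
  by have := imin k dk; have := ltn_ord i; have : k != i :> nat by []; lia.
rewrite addr0 subnK -1?ltnS // => dx0.
by rewrite -[_ u]scale1r -(mulVr (divR di)) -scalerA dx0 scaler0.
Qed.

End FiniteDimensional.

(** * Gluing along a direct sum *)

Section DirectSum.
Variables (R : nzRingType) (V : lmodType R) (I : choiceType) (W : I -> set V).
Hypothesis directW : direct_sum_decomposition W.
Implicit Types (v u : V) (i j : I) (g : I -> lend V).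
Local Open Scope fset_scope.

Lemma summandS i : subspace (W i). Proof. exact: directW.1. Qed.

Lemma summand0 i : W i 0.
Proof. by case/subspaceP: (summandS i). Qed.

(** The components of [v] are those of its unique decomposition.  Sums over
   larger index sets are allowed because two vectors then have a common index
   set, which makes linearity of the components visible. *)
Lemma components_exist : exists p : I -> V -> V,
  [/\ forall i v, W i (p i v),
      forall v, exists D : {fset I},
        forall D' : {fset I}, D `<=` D' -> v = \sum_(j <- D') p j v &
      forall (D : {fset I}) (f : I -> V) i, (forall j, W j (f j)) ->
        p i (\sum_(j <- D) f j) = if i \in D then f i else 0].
Proof.
have /choice[w wP] v : exists w : {fsfun I -> V with 0},
    [/\ forall i, W i (w i), v = \sum_(i <- finsupp w) w i &
        forall w' : {fsfun I -> V with 0}, (forall i, W i (w' i)) ->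
          v = \sum_(i <- finsupp w') w' i -> w = w'].
  have [w [[Ww vw] w_uniq]] := directW.2 v.
  by exists w; split=> // w' Ww' vw'; apply: w_uniq.
have sum_supp (w' : {fsfun I -> V with 0}) (D : {fset I}) : finsupp w' `<=` D ->
    \sum_(j <- D) w' j = \sum_(j <- finsupp w') w' j.
  move=> sub; apply/esym/big_fset_incl => // j _.
  by rewrite memNfinsupp => /eqP.
exists (fun i v => w v i); split=> [i v|v|D f i Wf].
- by have [] := wP v.
- by exists (finsupp (w v)) => D' /sum_supp ->; have [] := wP v.
have [_ _ w_uniq] := wP (\sum_(j <- D) f j).
rewrite (w_uniq [fsfun j in D => f j]); first by rewrite fsfunE.
  by move=> j; rewrite fsfunE; case: ifP => // _; apply: summand0.
rewrite -(sum_supp _ D (finsupp_sub _ _ _)).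
by apply: eq_big_seq => j jD; rewrite fsfunE jD.
Qed.

Record projections (p : I -> lend V) : Prop := Projections {
  proj_in : forall i v, W i (p i v);
  proj_id : forall i v, W i v -> p i v = v;
  proj_other : forall i j v, W j v -> i != j -> p i v = 0;
  proj_eq : forall v u, (forall i, p i v = p i u) -> v = u;
  proj_comm : forall f : lend V, (forall i, set_fun (W i) (W i) f) ->
    forall i v, f (p i v) = p i (f v);
  proj_glue : forall g : I -> lend V, (forall i, set_fun (W i) (W i) (g i)) ->
    exists y : lend V, forall i v, p i (y v) = g i (p i v) }.

(** A family of endomorphisms of the summands is glued by the formula
   [y v = \sum_j g_j (p_j v)] over the finitely many [j] with [p_j v != 0]; as
   vectors are determined by their components, linearity of [y] can be checked
   on each of them. *)
Lemma projections_exist : exists p : I -> lend V, projections p.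
Proof.
have [p [Wp p_sum sum_p]] := components_exist.
have p_sum2 v u : exists D : {fset I},
    v = \sum_(j <- D) p j v /\ u = \sum_(j <- D) p j u.
  have [[D1 D1P] [D2 D2P]] := (p_sum v, p_sum u); exists (D1 `|` D2).
  by split; [apply/D1P/fsubsetUl|apply/D2P/fsubsetUr].
have p0 i v (D : {fset I}) : v = \sum_(j <- D) p j v -> i \notin D -> p i v = 0.
  by move=> vE /negPf iD; rewrite vE sum_p // iD.
have glue (g : I -> lend V) : (forall i, set_fun (W i) (W i) (g i)) ->
    exists y : V -> V, forall i v, p i (y v) = g i (p i v).
  move=> gW; have [D DP] := choice p_sum.
  exists (fun v => \sum_(j <- D v) g j (p j v)) => i v; rewrite sum_p; last first.
    by move=> j; apply/gW/Wp.
  by case: ifPn => // /p0 -> //; [rewrite linear0|apply: DP].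
have p_eq v u : (forall i, p i v = p i u) -> v = u.
  move=> vu; have [D [-> ->]] := p_sum2 v u; apply: eq_bigr => j _.
  by rewrite vu.
have lin_p i : linear (p i).
  move=> a v u; have [D [vE uE]] := p_sum2 v u.
  rewrite {1}vE {1}uE scaler_sumr -big_split /= sum_p; last first.
    by move=> j; have sW := summandS j; apply: subspaceD => //; apply: subspaceZ.
  by case: ifPn => // iD; rewrite (p0 i v D) // (p0 i u D) // scaler0 addr0.
exists (fun i => lend_of_linear (lin_p i)); split=> //=.
- move=> i v Wv.
  have := sum_p [fset i] (fun j => if j == i then v else 0) i.
  rewrite big_seq_fset1 inE eqxx; apply=> j.
  by case: eqP => [->|_] //; apply: summand0.
- move=> i j v Wv ij.
  have := sum_p [fset j] (fun k => if k == j then v else 0) i.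
  rewrite big_seq_fset1 inE eqxx (negPf ij); apply=> k.
  by case: eqP => [->|_] //; apply: summand0.
- move=> f fW i v; have [D [vE _]] := p_sum2 v v.
  rewrite [in RHS]vE linear_sum sum_p => [|j]; last exact/fW/Wp.
  by case: ifPn => // /p0 -> //; rewrite linear0.
- move=> g /glue[y yP].
  suff lin_y : linear y by exists (lend_of_linear lin_y).
  move=> a v u; apply: p_eq => i.
  by rewrite lin_p !yP lin_p linearP.
Qed.

End DirectSum.

Section GlobalExistence.
Variables (R : unitRingType) (divR : GRing.field_axiom R) (V : lmodType R).
Variables (I : choiceType) (W : I -> set V).
Hypothesis directW : direct_sum_decomposition W.

Lemma sii_glue (p : I -> lend V) (x : lend V) : projections W p ->
    (forall i, set_fun (W i) (W i) x) -> (forall i, local_sii (p i) x) ->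
  exists y : lend V,
    strong_inner_inverse x y /\ forall i, set_fun (W i) (W i) y.
Proof.
move=> pP xW /choice[g gP].
have [Wp p_id p_other p_eq p_comm p_glue] := pP.
have gW i : set_fun (W i) (W i) (g i).
  by move=> v _; have [<- _ _] := gP i.
have [y yP] := p_glue _ gW.
have px n i v : p i ((x ^+ n) v) = (x ^+ n) (p i v).
  by rewrite -(comm_exp n (fun v => p_comm x xW i v)).
have py n i v : p i ((y ^+ n) v) = (g i ^+ n) (p i v).
  by elim: n => [//|n IH]; rewrite !lendXS yP IH.
exists y; split=> [i j k ij kj|i v Wv].
  apply: lendP => v; apply: p_eq => l; rewrite !lendM !(px, py).
  by have [_ _ sii] := gP l; apply: sii => //; exists v.
suff -> : y v = p i (y v) by [].
apply: p_eq => j; have [->|ji] := eqVneq j i; first by rewrite [RHS]p_id.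
by rewrite yP (p_other _ _ _ Wv ji) linear0 (p_other _ _ _ (Wp i _) ji).
Qed.

Lemma sii_exists (x : lend V) : (forall i, set_fun (W i) (W i) x) ->
  (forall i : I, [\/ finite_dimensional (W i), set_inj (W i) x
                   | set_surj (W i) (W i) x]) ->
  exists y : lend V,
    strong_inner_inverse x y /\ forall i, set_fun (W i) (W i) y.
Proof.
move=> xW typeW; have [p pP] := projections_exist directW.
have [Wp p_id _ _ p_comm _] := pP.
apply: (sii_glue pP xW) => i.
have pp v : p i (p i v) = p i v by rewrite p_id.
have xp v : x (p i v) = p i (x v) by apply: p_comm.
case: (typeW i) => [/(finite_dimensional_stable divR)/(_ (xW i))[n st]|xinj|xsurj].
- by apply: (local_sii_stable divR pp xp) => v; apply: st.
- apply: (local_sii_stable (n := 0) divR pp xp) => v; rewrite expr1 => xv.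
  by apply: xinj; rewrite ?linear0 //; apply/mem_set; [apply: Wp|apply: summand0].
- apply: (local_sii_surj divR pp xp) => _ [v _ <-].
  have [u Wu xu] := xsurj _ (Wp i v).
  by exists u => //; exists u; rewrite ?p_id.
Qed.

End GlobalExistence.

(** * Normal forms in the monoid *)

Section NormalForm.

Definition normal_word (t : nat * nat * nat) : seq bool :=
  nseq t.1.1 true ++ nseq t.1.2 false ++ nseq t.2 true.

Definition normal (t : nat * nat * nat) : bool := (t.1.1 <= t.1.2)%N && (t.2 <= t.1.2)%N.

Lemma F_cong_cons l u v : F_cong u v -> F_cong (l :: u) (l :: v).
Proof. by move=> uv; apply: (F_cong_cat (F_cong_refl [:: l]) uv). Qed.

(** Induction on [w], prepending a letter to [x^i y^j x^k].  Nothing is to be done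
   for [x] if [i < j], nor for [y] if [i = 0].  Otherwise the word is rewritten as
   [y^(j - i) x^j y^(j - k)], which absorbs the letter and is then recognized as
   the right-hand side of the relation for [(j + 1, j + 1, k + 1)], respectively
   for [(i - 1, j, k)]. *)
Lemma normal_word_exists w : exists t, normal t /\ F_cong w (normal_word t).
Proof.
have rel i j k : (i <= j)%N -> (k <= j)%N ->
    F_cong (normal_word (i, j, k))
           (nseq (j - i) false ++ nseq j true ++ nseq (j - k) false).
  exact: F_cong_rel.
elim: w => [|l w [[[i j] k] [/andP[/= ij kj] IH]]].
  by exists (0, 0, 0)%N; split=> //; apply: F_cong_refl.
have {IH} := F_cong_cons l IH; case: l => IH.
- have [i_lt_j|j_le_i] := ltnP i j.
    by exists (i.+1, j, k); rewrite /normal /= i_lt_j.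
  have {ij j_le_i} ij : i = j by lia.
  rewrite {i}ij in IH *; exists (j.+1, j.+1, k.+1).
  split; first by rewrite /normal /= !ltnS leqnn.
  apply: F_cong_trans IH _.
  apply: F_cong_trans (F_cong_cons _ (rel _ _ _ (leqnn j) kj)) _.
  by apply: F_cong_sym; have := rel j.+1 j.+1 k.+1 (leqnn _) kj; rewrite !subnn subSS.
- case: i ij IH => [|i] ij IH.
    by exists (0, j.+1, k)%N; rewrite /normal /= leqW.
  exists (i, j, k); split; first by rewrite /normal /= (ltnW ij).
  apply: F_cong_trans IH _.
  apply: F_cong_trans (F_cong_cons _ (rel _ _ _ ij kj)) _.
  by apply: F_cong_sym; have := rel i j k (ltnW ij) kj; rewrite -(subnSK ij).
Qed.

Lemma normal_form_exists : exists nf : monF -> nat * nat * nat,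
  forall f, normal (nf f) /\ f = F_of (normal_word (nf f)).
Proof.
have /choice[nf nfP] (f : monF) : exists t, normal t /\ f = F_of (normal_word t).
  have [t [nt ft]] := normal_word_exists (repr f).
  by exists t; split=> //; rewrite -[LHS]F_of_surj; apply/F_ofP.
by exists nf.
Qed.

Lemma normal_inj (nf : monF -> nat * nat * nat) :
  (forall f, normal (nf f) /\ f = F_of (normal_word (nf f))) -> injective nf.
Proof. by move=> nfP f g fg; rewrite (nfP f).2 (nfP g).2 fg. Qed.

End NormalForm.

(** * Representations of the monoid ring *)

Section MonoidRing.
Variables (R : nzRingType) (E : pzRingType) (a : {rmorphism R -> E}) (x y : E).
Hypothesis sii : strong_inner_inverse x y.
Hypothesis comm_ax : forall d, GRing.comm (a d) x.
Hypothesis comm_ay : forall d, GRing.comm (a d) y.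

Definition letters_prod (w : seq bool) : E := \prod_(l <- w) if l then x else y.

Lemma letters_prod_nseq n l : letters_prod (nseq n l) = (if l then x else y) ^+ n.
Proof.
by elim: n => [|n IH]; rewrite /letters_prod /= ?big_nil // big_cons [X in _ * X]IH exprS.
Qed.

Lemma letters_prod_cong u v : F_cong u v -> letters_prod u = letters_prod v.
Proof.
elim=> {u v} // [i j k ij kj|u v w _ -> _ ->|u u' v v' _ + _] //.
  by rewrite /letters_prod !big_cat /= -!/(letters_prod _) !letters_prod_nseq !mulrA sii.
by rewrite /letters_prod !big_cat /= => -> ->.
Qed.

Definition F_eval (f : monF) : E := letters_prod (repr f).

Lemma F_eval_of w : F_eval (F_of w) = letters_prod w.
Proof. by apply/letters_prod_cong/F_ofP; rewrite F_of_surj. Qed.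

Lemma F_evalM f g : F_eval (mmul f g) = F_eval f * F_eval g.
Proof. by rewrite [mmul f g]/(F_mul f g) F_eval_of /letters_prod big_cat. Qed.

Lemma F_eval1 : F_eval mone = 1.
Proof. by apply: etrans (F_eval_of [::]) _; rewrite /letters_prod big_nil. Qed.

Lemma F_eval_normal t :
  F_eval (F_of (normal_word t)) = x ^+ t.1.1 * y ^+ t.1.2 * x ^+ t.2.
Proof.
rewrite F_eval_of /letters_prod !big_cat /= -!/(letters_prod _).
by rewrite !letters_prod_nseq mulrA.
Qed.

Lemma F_eval_comm d f : GRing.comm (a d) (F_eval f).
Proof. by apply: commr_prod => -[]. Qed.

Definition malg_eval (p : {malg R[monF]}) : E :=
  \sum_(f <- msupp p) a p@_f * F_eval f.

Lemma malg_evalEw (S : {fset monF}) p : (msupp p `<=` S)%fset ->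
  malg_eval p = \sum_(f <- S) a p@_f * F_eval f.
Proof.
move=> le; rewrite [LHS](big_fset_incl _ le) => //= f _ /mcoeff_outdom ->.
by rewrite rmorph0 mul0r.
Qed.

Lemma malg_evalU d f : malg_eval << d *g f >> = a d * F_eval f.
Proof. by rewrite (malg_evalEw msuppU_le) big_seq_fset1 mcoeffUU. Qed.

Lemma malg_eval_zmod_morphism : zmod_morphism malg_eval.
Proof.
move=> p q; set S := (msupp p `|` msupp q `|` msupp (p - q))%fset.
rewrite !(@malg_evalEw S).
- by rewrite -sumrB; apply: eq_bigr => f _; rewrite mcoeffB rmorphB mulrBl.
- by rewrite /S -fsetUA fsetUCA fsubsetUl.
- by rewrite /S -fsetUA fsubsetUl.
- exact: fsubsetUr.
Qed.

HB.instance Definition _ := GRing.isZmodMorphism.Build {malg R[monF]} E malg_eval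
  malg_eval_zmod_morphism.

Lemma malg_eval_monoid_morphism : monoid_morphism malg_eval.
Proof.
split=> [|p q]; first by rewrite malg_evalU rmorph1 mul1r F_eval1.
rewrite malgME raddf_sum mulr_suml /=; apply: eq_bigr => f _.
rewrite raddf_sum mulr_sumr /=; apply: eq_bigr => g _.
by rewrite malg_evalU rmorphM F_evalM -!mulrA; congr (_ * _); rewrite !mulrA F_eval_comm.
Qed.

Definition malg_eval_rmorphism : {rmorphism {malg R[monF]} -> E} :=
  HB.pack malg_eval
    (GRing.isMonoidMorphism.Build {malg R[monF]} E malg_eval
       malg_eval_monoid_morphism).

Lemma malg_eval_inj : (forall p, malg_eval p = 0 -> p = 0) -> injective malg_eval.
Proof. exact: raddf_inj. Qed.

Lemma malg_evalC d : malg_eval d%:MP = a d.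
Proof. by rewrite malg_evalU F_eval1 mulr1. Qed.

Lemma malg_eval_x : malg_eval << F_x >> = x.
Proof. by rewrite malg_evalU rmorph1 mul1r F_eval_of /letters_prod big_seq1. Qed.

Lemma malg_eval_y : malg_eval << F_y >> = y.
Proof. by rewrite malg_evalU rmorph1 mul1r F_eval_of /letters_prod big_seq1. Qed.

(** Stability under multiplication by the scalars is an explicit hypothesis so
   that [S] may be a subring containing them as well as a subalgebra. *)
Lemma malg_eval_in (S : set E) : GRing.subring_closed (mem S) ->
  S x -> S y -> (forall d e, S e -> S (a d * e)) -> forall p, S (malg_eval p).
Proof.
move=> subS Sx Sy Sa p.
have S1 : S 1 by apply/set_mem; case: subS.
have SM u v : S u -> S v -> S (u * v).
  by move=> /mem_set Su /mem_set Sv; apply/set_mem; case: subS => _ _; apply.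
have SB u v : S u -> S v -> S (u - v).
  by move=> /mem_set Su /mem_set Sv; apply/set_mem; case: subS => _ + _; apply.
have S0 : S 0 by rewrite -(subrr 1); apply: SB.
have SD u v : S u -> S v -> S (u + v).
  by move=> Su Sv; rewrite -[v]opprK -[- v]sub0r; apply/SB/SB.
rewrite /malg_eval; elim/big_ind: _ => // f _; apply: Sa.
by rewrite /F_eval /letters_prod; elim/big_ind: _ => // -[].
Qed.

Lemma malg_eval_subring_closed : GRing.subring_closed (mem (range malg_eval)).
Proof.
pose phi := malg_eval_rmorphism; have phiE : malg_eval = phi by [].
rewrite phiE; split=> [|_ _ /set_mem[p _ <-] /set_mem[q _ <-]
  |_ _ /set_mem[p _ <-] /set_mem[q _ <-]]; apply/mem_set.
- by exists 1; rewrite ?rmorph1.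
- by exists (p - q); rewrite ?rmorphB.
- by exists (p * q); rewrite ?rmorphM.
Qed.

Lemma malg_eval_generate : (forall p, malg_eval p = 0 -> p = 0) ->
  generate_monoid_ring a x y.
Proof.
move=> /malg_eval_inj inj; exists malg_eval_rmorphism; split=> //.
- exact: malg_evalC.
- exact: malg_eval_x.
- exact: malg_eval_y.
apply/seteqP; split=> [_ [p _ <-] S [closS genS]|].
  apply: malg_eval_in => // [||d e Se]; first by apply: genS; right; left.
    by apply: genS; right; right.
  case: closS => _ _ SM; apply/set_mem/SM; apply/mem_set => //.
  by apply: genS; left; exists d.
apply: smallest_sub; first exact: malg_eval_subring_closed.
move=> _ [[d _ <-]|[->|->]].
- by exists d%:MP => //; apply: malg_evalC.
- by exists << F_x >> => //; apply: malg_eval_x.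
- by exists << F_y >> => //; apply: malg_eval_y.
Qed.

End MonoidRing.

(** * Linear independence of the normal words *)

Section Independence.
Variables (R : unitRingType) (divR : GRing.field_axiom R) (V : lmodType R).
Implicit Types (x y : lend V) (t v : V).

(** Let [(i, j, k)] be the triple of [f], and let [t] generate a string of length
   [j + 1].  The word of [f] followed by [y^i] sends [x^(j - k) t] to [t].  A
   word with triple [(i', j', k')] followed by [y^i] kills this vector unless
   [k' <= k], [j' - k' <= j - k] and [i <= i' + k' + (j - k) - j']; these force
   [2j' - i' <= 2j - i], with equality only for the same triple.  So induction on
   [2j - i] isolates the coefficient of [f]. *)
Lemma words_independent x y (T : eqType) (nf : T -> nat * nat * nat)
    (s : seq T) (d : T -> R) :
    (forall n, exists t, shift_string n x y t /\ t != 0) ->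
    injective nf -> (forall f, normal (nf f)) -> uniq s ->
    (forall v, \sum_(f <- s)
       d f *: (x ^+ (nf f).1.1 * y ^+ (nf f).1.2 * x ^+ (nf f).2) v = 0) ->
  forall f, f \in s -> d f = 0.
Proof.
move=> strs inj_nf nfP uniq_s sum0 f.
have [m] := ubnP ((nf f).1.2.*2 - (nf f).1.1)%N; elim: m f => // m IH f ltm fs.
have [t [st t0]] := strs (nf f).1.2.
have := congr1 (y ^+ (nf f).1.1) (sum0 ((x ^+ ((nf f).1.2 - (nf f).2)) t)).
have /andP[af cf] := nfP f.
have down l := @shift_string_down _ _ _ _ _ _ (nf f).1.1 l st.
rewrite linear0 linear_sum (bigD1_seq f) //= big1_seq => [|g /andP[gf gs]].
  rewrite addr0 linearZ /= (shift_string_word _ _ _ st) ?leq_subr //.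
  have -> : ((nf f).1.2 <= (nf f).2 + ((nf f).1.2 - (nf f).2) <= (nf f).1.2)%N by lia.
  rewrite down; last by lia.
  rewrite ifT; last by lia.
  rewrite (_ : (_ - _)%N = 0%N); last by lia.
  move=> dt; apply/eqP/negPn/negP => /divR Ud; case/eqP: t0.
  by rewrite -[t]scale1r -(mulVr Ud) -scalerA [X in _ *: X]dt scaler0.
have /andP[ag cg] := nfP g; rewrite linearZ /= (shift_string_word _ _ _ st) ?leq_subr //.
case: ifP => [/andP[c1 c2]|_]; last by rewrite linear0 scaler0.
rewrite down; last by lia.
case: ifP => [c3|_]; last by rewrite scaler0.
rewrite IH ?scale0r //.
have nfgf : nf g != nf f by rewrite (inj_eq inj_nf).
suff: ((nf g).1.2.*2 - (nf g).1.1 < (nf f).1.2.*2 - (nf f).1.1)%N by lia.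
rewrite ltnNge; apply: contra_neqN nfgf => le.
rewrite (surjective_pairing (nf g)) (surjective_pairing (nf g).1).
rewrite (surjective_pairing (nf f)) (surjective_pairing (nf f).1).
by congr (_, _, _); lia.
Qed.

(** If [b] is the first vector of the given basis, then [t = y^n x^n b] is nonzero
   since [x^n y^n x^n = x^n].  The relations give [x^l t = y^(n - l) x^n b] for
   [l <= n], on which [y] is visibly the downward shift, and
   [y t = y^(n + 1) x^(n + 1) (y b) = 0] because [x^(n + 1)] vanishes on [W]. *)
Lemma basic_shift_string n x y W : basic_of_dim x W n.+1 ->
    strong_inner_inverse x y -> set_fun W W y ->
  exists t, shift_string n x y t /\ t != 0.
Proof.
move=> [sW xW _ [b [[Wb bW] bS bn]]] sii yW.
have siiv i j k v : (i <= j)%N -> (k <= j)%N ->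
    (x ^+ i) ((y ^+ j) ((x ^+ k) v)) = (y ^+ (j - i)) ((x ^+ j) ((y ^+ (j - k)) v)).
  by move=> ij kj; have := congr1 (fun f : lend V => f v) (sii i j k ij kj).
have bE (h : 'I_n.+1) : b h = (x ^+ h) (b ord0).
  case: h; elim=> [|h IH] hn; first by congr (b _); apply: val_inj.
  by rewrite lendXS -(IH (ltnW hn)); apply/esym/bS.
have xb0 : (x ^+ n.+1) (b ord0) = 0 by rewrite lendXS -(bE ord_max) bn.
have xW0 v : W v -> (x ^+ n.+1) v = 0.
  move=> /bW[c [-> _]]; rewrite linear_sum big1 // => i _.
  by rewrite linearZ /= bE -lendXD addnC lendXD xb0 linear0 scaler0.
pose t := (y ^+ n) ((x ^+ n) (b ord0)); exists t; split; last first.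
  apply/eqP => t0; have := siiv n n n (b ord0) (leqnn n) (leqnn n).
  rewrite -/t t0 linear0 subnn -(bE ord_max) => bmax.
  have bmax0 : b ord_max = 0 := esym bmax.
  have [] := bW 0; first by case/subspaceP: sW.
  (* If the last basis vector were 0, then 0 would have two expansions. *)
  move=> c [_ c_uniq]; have /(congr1 (fun f : {ffun _ -> R} => f ord_max)) :
      [ffun=> 0] = [ffun i : 'I_n.+1 => (i == ord_max)%:R] :> {ffun _ -> R}.
    transitivity c.
      by apply/esym/c_uniq; rewrite big1 // => i _; rewrite ffunE scale0r.
    apply/c_uniq; rewrite big1 // => i _; rewrite ffunE.
    by case: eqP => [->|_]; rewrite ?bmax0 ?scaler0 ?scale0r.
  by rewrite !ffunE eqxx => /esym/eqP; rewrite oner_eq0.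
have Wt : W t by apply: (@set_fun_exp _ _ W y n yW); apply: (@set_fun_exp _ _ W x n xW).
split; first exact: xW0.
  rewrite -lendXS -[_ (_ (b _))]/((x ^+ 0) ((y ^+ n.+1) ((x ^+ n) (b ord0)))).
  rewrite siiv // subSnn expr1 xW0 ?linear0 //; exact: yW.
move=> l ln; have xt k : (k <= n)%N -> (x ^+ k) t = (y ^+ (n - k)) ((x ^+ n) (b ord0)).
  by move=> kn; rewrite siiv // subnn.
by rewrite xt // xt ?(ltnW ln) // -lendXS subnSK.
Qed.

End Independence.

(** * Faithfulness of the representations *)

Section Evaluation.
Variables (R : nzRingType) (V : lmodType R).

Lemma zend_ofX (x : lend V) n v : (zend_of x ^+ n) v = (x ^+ n) v.
Proof. by elim: n => [//|n IH]; rewrite lendXS -IH exprS. Qed.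

Lemma zend_of_sii (x y : lend V) : strong_inner_inverse x y ->
  strong_inner_inverse (zend_of x) (zend_of y).
Proof.
move=> sii i j k ij kj; apply: zendP => v.
have := congr1 (fun f : lend V => f v) (sii i j k ij kj).
by rewrite !lendM -!zend_ofX.
Qed.

Lemma converseX (E : pzRingType) (u : E) n : (u : E^c) ^+ n = u ^+ n.
Proof. by elim: n => [//|n IH]; rewrite exprS exprSr IH. Qed.

(** Reversing words exchanges the relations for [(i, j, k)] and [(k, j, i)]. *)
Lemma converse_sii (E : pzRingType) (x y : E) : strong_inner_inverse x y ->
  @strong_inner_inverse E^c x y.
Proof.
move=> sii i j k ij kj; rewrite !converseX.
have sii' := sii k j i kj ij; rewrite -!mulrA in sii'.
rewrite [LHS]/((x ^+ k : E) * (y ^+ j * x ^+ i)).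
by rewrite [LHS]sii'.
Qed.

Lemma scal_zmod_morphism : zmod_morphism (scal V).
Proof. by move=> d e; apply: zendP => v /=; rewrite scalerBl. Qed.

Lemma scal_monoid_morphism : monoid_morphism (scal V).
Proof.
by split=> [|d e]; apply: zendP => v /=; rewrite ?scale1r // -scalerA.
Qed.

HB.instance Definition _ := GRing.isZmodMorphism.Build R (zend V) (scal V)
  scal_zmod_morphism.
HB.instance Definition _ := GRing.isMonoidMorphism.Build R (zend V) (scal V)
  scal_monoid_morphism.

Lemma scal_comm d (f : lend V) : scal V d * zend_of f = zend_of f * scal V d.
Proof. by apply: zendP => v /=; rewrite linearZ. Qed.

End Evaluation.

Section OppositeScalars.
Variables (D : nzRingType) (V : lmodType D^c).

(** The right action of [D] reverses products, so it is a ring morphism from [D]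
   itself into the opposite of the endomorphism ring. *)
Definition scal_opp : D -> (zend V)^c := scal V.

Lemma scal_opp_zmod_morphism : zmod_morphism scal_opp.
Proof. by move=> d e; apply: zendP => v /=; rewrite /scal_opp /= scalerBl. Qed.

Lemma scal_opp_monoid_morphism : monoid_morphism scal_opp.
Proof.
split=> [|d e]; apply: zendP => v; first exact: scale1r.
by rewrite -[RHS]/((e : D^c) *: ((d : D^c) *: v)) scalerA.
Qed.

HB.instance Definition _ := GRing.isZmodMorphism.Build D (zend V)^c scal_opp
  scal_opp_zmod_morphism.
HB.instance Definition _ := GRing.isMonoidMorphism.Build D (zend V)^c scal_opp
  scal_opp_monoid_morphism.

End OppositeScalars.

Section Faithful.
Variables (D : unitRingType) (divD : GRing.field_axiom D) (V : lmodType D^c).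
Variables (x y : lend V).
Hypothesis sii : strong_inner_inverse x y.
Hypothesis strs : forall n, exists t, shift_string n x y t /\ t != 0.

Lemma zend_of_word i j k v :
  (zend_of x ^+ i * zend_of y ^+ j * zend_of x ^+ k) v = (x ^+ i * y ^+ j * x ^+ k) v.
Proof.
transitivity ((zend_of x ^+ i) ((zend_of y ^+ j) ((zend_of x ^+ k) v))) => //.
by rewrite !zend_ofX.
Qed.

Lemma word_combination_eq0 (nf : monF -> nat * nat * nat) (S : seq monF)
    (d : monF -> D^c) :
    injective nf -> (forall f, normal (nf f)) -> uniq S ->
    \sum_(f <- S) scal V (d f) * (zend_of x ^+ (nf f).1.1 *
      zend_of y ^+ (nf f).1.2 * zend_of x ^+ (nf f).2) = 0 ->
  forall f, f \in S -> d f = 0.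
Proof.
move=> inj_nf nfP uS sum0.
apply: (words_independent (divD : GRing.field_axiom D^c) strs inj_nf nfP uS).
move=> v; rewrite -[RHS]/((0 : zend V) v) -sum0.
elim: (S) => [|f S' IH]; rewrite ?big_nil // !big_cons IH.
by rewrite -zend_of_word.
Qed.

Lemma generate_monoid_ring_usual :
  @generate_monoid_ring D^c (zend V) (scal V) (zend_of x) (zend_of y).
Proof.
apply: (@malg_eval_generate D^c (zend V) (scal V) _ _ (zend_of_sii sii)).
- by move=> d; apply: scal_comm.
- by move=> d; apply: scal_comm.
move=> p p0; have [nf nfP] := normal_form_exists.
apply/malgP => f; rewrite mcoeff0.
have [fp|/mcoeff_outdom //] := boolP (f \in msupp p).
apply: (word_combination_eq0 (d := fun f => p@_f) (normal_inj nfP)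
  (fun f => (nfP f).1) (fset_uniq _) _ fp).
rewrite -[RHS]p0; apply: eq_bigr => g _.
congr (_ * _); rewrite [in RHS](nfP g).2 F_eval_normal //; exact: zend_of_sii.
Qed.

(** In the opposite ring [x^i y^j x^k] is the composite [x^k y^j x^i], so the
   independence of words is used for the reversed triples. *)
Lemma generate_monoid_ring_opposite :
  @generate_monoid_ring D (zend V)^c (scal V) (zend_of x) (zend_of y).
Proof.
have siic := converse_sii (zend_of_sii sii).
have commc d (f : lend V) : @GRing.comm (zend V)^c (scal_opp V d) (zend_of f).
  by apply/esym; apply: scal_comm.
apply: (@malg_eval_generate D (zend V)^c (scal_opp V) _ _ siic
  (commc^~ x) (commc^~ y)) => p p0.
have [nf nfP] := normal_form_exists.
apply/malgP => f; rewrite mcoeff0.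
have [fp|/mcoeff_outdom //] := boolP (f \in msupp p).
pose nf' f := ((nf f).2, (nf f).1.2, (nf f).1.1).
have inj_nf' : injective nf'.
  move=> g h; rewrite /nf' => -[e1 e2 e3]; apply: (normal_inj nfP).
  by case: (nf g) (nf h) e1 e2 e3 => [[? ?] ?] [[? ?] ?] /= -> -> ->.
have nfP' g : normal (nf' g) by rewrite /normal andbC; case: (nfP g).
apply: (word_combination_eq0 (d := fun f => p@_f) inj_nf' nfP' (fset_uniq _) _ fp).
rewrite -[RHS]p0; apply: eq_bigr => g _.
rewrite (F_eval_comm (commc^~ x) (commc^~ y)).
have Eg : zend_of x ^+ (nf g).2 * zend_of y ^+ (nf g).1.2 * zend_of x ^+ (nf g).1.1 =
    @F_eval (zend V)^c (zend_of x) (zend_of y) g :> zend V.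
  by rewrite [in RHS](nfP g).2 F_eval_normal // !converseX -mulrA.
exact: (congr1 (fun h : zend V => scal V p@_g * h) Eg).
Qed.

(** Commutativity makes the right action a ring morphism on [D] itself for the
   usual composition, so that scalars multiply as in the monoid algebra. *)
Lemma generate_monoid_algebra_usual : commutative (@GRing.mul D) ->
  generate_monoid_algebra (zend_of x) (zend_of y).
Proof.
move=> mulDC; pose a0 : D -> zend V := scal V.
have a0B : zmod_morphism a0 by move=> d e; apply: (@scal_zmod_morphism D^c V).
have a0M : monoid_morphism a0.
  split=> [|d e]; first exact: (@scal_monoid_morphism D^c V).1.
  by rewrite mulDC; apply: (@scal_monoid_morphism D^c V).2.
pose a : {rmorphism D -> zend V} := HB.pack a0
  (GRing.isZmodMorphism.Build D (zend V) a0 a0B)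
  (GRing.isMonoidMorphism.Build D (zend V) a0 a0M).
have siiz := zend_of_sii sii.
have ax d : GRing.comm (a d) (zend_of x) by apply: scal_comm.
have ay d : GRing.comm (a d) (zend_of y) by apply: scal_comm.
pose phi := malg_eval_rmorphism siiz ax ay.
have phiZ (d : D) p : phi (d *: p) = scal V d * phi p.
  by rewrite -mul_malgC rmorphM; congr (_ * _); apply: (malg_evalC a).
exists phi; split=> //.
- apply: malg_eval_inj => p p0; have [nf nfP] := normal_form_exists.
  apply/malgP => f; rewrite mcoeff0.
  have [fp|/mcoeff_outdom //] := boolP (f \in msupp p).
  apply: (word_combination_eq0 (d := fun f => p@_f) (normal_inj nfP)
    (fun f => (nfP f).1) (fset_uniq _) _ fp).
  rewrite -[RHS]p0; apply: eq_bigr => g _.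
  by congr (_ * _); rewrite [in RHS](nfP g).2 F_eval_normal.
- exact: (malg_eval_x a).
- exact: (malg_eval_y a).
apply/seteqP; split=> [_ [p _ <-] S [[closS closZ] genS]|].
  by apply: malg_eval_in => //; apply: genS; [left|right].
apply: smallest_sub.
  split=> [|d _ [p _ <-]]; first exact: malg_eval_subring_closed.
  by exists ((d : D) *: p) => //; rewrite -[LHS]/(phi _) phiZ.
move=> _ [->|->].
- by exists << F_x >> => //; apply: (malg_eval_x a).
- by exists << F_y >> => //; apply: (malg_eval_y a).
Qed.

End Faithful.

Theorem theorem5 (D : unitRingType) (divD : GRing.field_axiom D)
    (V : lmodType D^c) (x : lend V) (I : choiceType) (W : I -> set V)
    (directW : direct_sum_decomposition W)
    (invW : forall i : I, set_fun (W i) (W i) x)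
    (typeW : forall i : I,
       [\/ finite_dimensional (W i), set_inj (W i) x
         | set_surj (W i) (W i) x]) :
  (exists y : lend V,
     strong_inner_inverse x y /\ forall i : I, set_fun (W i) (W i) y) /\
  ((forall n : nat, (0 < n)%N -> exists i : I, basic_of_dim x (W i) n) ->
   exists y : lend V,
     [/\ strong_inner_inverse x y,
         @generate_monoid_ring D (zend V)^c (scal V) (zend_of x) (zend_of y),
         @generate_monoid_ring D^c (zend V) (scal V) (zend_of x) (zend_of y) &
         commutative (@GRing.mul D) ->
           generate_monoid_algebra (zend_of x) (zend_of y)]).
Proof.
have [y [sii yW]] := @sii_exists D^c divD V I W directW x invW typeW.
split=> [|basicW]; first by exists y.
have strs n : exists t, shift_string n x y t /\ t != 0.
  have [i Wi] := basicW n.+1 isT.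
  exact: (basic_shift_string Wi sii (yW i)).
exists y; split=> //.
- exact: generate_monoid_ring_opposite.
- exact: generate_monoid_ring_usual.
- exact: generate_monoid_algebra_usual.
Qed.
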